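(* Let $A$ be a finite alphabet, $p$ a prime, $u\in A^*$ a non-empty word, and $\mathfrak{M}\in\mathbb{F}_p[q]$ a polynomial of degree at least $1$. Define the relation $\equiv_{u,\mathfrak{M}}$ on $A^*$ by $w_1\equiv_{u,\mathfrak{M}}w_2$ if (i) $w_1\sim_{u,\mathfrak{M}}w_2$; and (ii) $q^{|w_1|}\equiv q^{|w_2|}\pmod{\mathfrak{M}}$; and (iii) $|w_1|=|w_2|$, or $\operatorname{val}\left(\binom{w_i}{v}_q\right)+|w_i|-|v|\ge\operatorname{val}(\mathfrak{M})$ for all $i\in\{1,2\}$ and all $v\in A^*$ such that $av\in\operatorname{Fac}(u)$ for some $a\in A$. Then $\equiv_{u,\mathfrak{M}}$ is a congruence on $A^*$. Moreover, it is the coarsest congruence refining $\sim_{u,\mathfrak{M}}$.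
   Context: $A^*$ is the free monoid of finite words over $A$ (with concatenation and empty word $\varepsilon$), and $|w|$ is the length of a word $w$. The $q$-binomial coefficient $\binom{u}{v}_q\in\mathbb{N}[q]$ of two words $u,v\in A^*$ is defined recursively by $\binom{u}{\varepsilon}_q=1$, $\binom{\varepsilon}{v}_q=0$ if $v\neq\varepsilon$, and, for all $u,v\in A^*$ and letters $a,b\in A$, $\binom{ua}{vb}_q=q^{|vb|}\binom{u}{vb}_q+\delta_{a,b}\binom{u}{v}_q$, where $\delta_{a,b}$ is the Kronecker delta. The integer coefficients of $\binom{u}{v}_q$ are reduced modulo $p$ to view it in $\mathbb{F}_p[q]$. $\operatorname{Fac}(u)$ is the set of factors of $u$, i.e. the words $f$ with $u=xfs$ for some $x,s\in A^*$. Write $w_1\sim_{u,\mathfrak{M}}w_2$ if $\binom{w_1}{v}_q\equiv\binom{w_2}{v}_q\pmod{\mathfrak{M}}$ for all $v\in\operatorname{Fac}(u)$. For $\mathfrak{P}\in\mathbb{F}_p[q]$, $\operatorname{val}(\mathfrak{P})$ is the largest $\ell$ such that $q^\ell$ divides $\mathfrak{P}$, with $\operatorname{val}(0)=+\infty$. A congruence on $A^*$ is an equivalence relation compatible with concatenation on both sides. An equivalence relation $\cong$ refines $\sim$ (and $\sim$ is coarser than $\cong$) if $w_1\cong w_2$ implies $w_1\sim w_2$. ''Coarsest'' means: it is a congruence refining $\sim_{u,\mathfrak{M}}$, and every congruence refining $\sim_{u,\mathfrak{M}}$ refines it. *)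

(* Defs.v *)
From HB Require Import structures.
From mathcomp Require Import all_boot all_order all_algebra.
From mathcomp Require Import constructive_ereal.

Set Implicit Arguments.
Unset Strict Implicit.
Unset Printing Implicit Defensive.

Import Order.TTheory GRing.Theory Num.Theory.
Local Open Scope ring_scope.

(* The defining recursion peels off last letters, hence the reversal;
   the recursion on words themselves is qbinom0, qbinom0l, qbinom_rcons. *)
Fixpoint qbinom_rev (A : finType) (u v : seq A) {struct u} : {poly nat} :=
  match v, u with
  | [::], _ => 1
  | _ :: _, [::] => 0
  | b :: v', a :: u' =>
      'X^(size v) * qbinom_rev u' v + (a == b)%:R * qbinom_rev u' v'
  end.

Definition qbinom (A : finType) (u v : seq A) : {poly nat} :=
  qbinom_rev (rev u) (rev v).

Lemma qbinom0 (A : finType) (u : seq A) : qbinom u [::] = 1.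
Proof. by rewrite /qbinom; case: (rev u). Qed.

Lemma qbinom0l (A : finType) (v : seq A) : v != [::] -> qbinom [::] v = 0.
Proof. by case/lastP: v => // v b _; rewrite /qbinom rev_rcons. Qed.

Lemma qbinom_rcons (A : finType) (u v : seq A) (a b : A) :
  qbinom (rcons u a) (rcons v b) =
  'X^(size (rcons v b)) * qbinom u (rcons v b) + (a == b)%:R * qbinom u v.
Proof. by rewrite /qbinom !rev_rcons /= size_rev size_rcons. Qed.

Definition qbinomp (A : finType) (p : nat) (u v : seq A) : {poly 'F_p} :=
  map_poly (fun n : nat => n%:R) (qbinom u v).

Definition eqmodp (p : nat) (M P Q : {poly 'F_p}) : Prop := M %| P - Q.

(* mup 0 P, the multiplicity of 0 as a root of P, is the largest l such that
   'X^l divides P when P != 0 (see qvalP).  The values are extended integers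
   because |w| - |v| may be negative in the condition below. *)
Definition qval (p : nat) (P : {poly 'F_p}) : \bar int :=
  if P == 0 then +oo%E else ((mup 0 P)%:Z)%:E.

Lemma qvalP (p : nat) (P : {poly 'F_p}) (l : nat) :
  ('X^l %| P) = ((l%:Z)%:E <= qval P)%E.
Proof.
rewrite /qval; case: eqVneq => [->|P0]; first by rewrite dvdp0 leey.
by rewrite lee_fin lez_nat mup_geq // subr0.
Qed.

Definition factor_sim (A : finType) (p : nat) (u : seq A) (M : {poly 'F_p})
    (w1 w2 : seq A) : Prop :=
  forall v, infix v u -> eqmodp M (qbinomp p w1 v) (qbinomp p w2 v).

Definition val_cond (A : finType) (p : nat) (M : {poly 'F_p})
    (w v : seq A) : Prop :=
  (qval (qbinomp p w v) + (size w)%:Z%:E - (size v)%:Z%:E >= qval M)%E.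

Definition factor_equiv (A : finType) (p : nat) (u : seq A) (M : {poly 'F_p})
    (w1 w2 : seq A) : Prop :=
  [/\ factor_sim u M w1 w2,
      eqmodp M 'X^(size w1) 'X^(size w2) &
      size w1 = size w2 \/
      (forall v, (exists a, infix (a :: v) u) ->
         val_cond M w1 v /\ val_cond M w2 v)].

Definition congruence (A : finType) (R : seq A -> seq A -> Prop) : Prop :=
  RelationClasses.Equivalence R /\
  forall x y w1 w2, R w1 w2 -> R (x ++ w1 ++ y) (x ++ w2 ++ y).

Definition refines (A : finType) (R S : seq A -> seq A -> Prop) : Prop :=
  forall w1 w2, R w1 w2 -> S w1 w2.

Definition coarsest_congruence_refining (A : finType)
    (S R : seq A -> seq A -> Prop) : Prop :=
  [/\ congruence R, refines R S &
      forall R' : seq A -> seq A -> Prop,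
        congruence R' -> refines R' S -> refines R' R].

(* Main.v *)
(** Write [M = q^m N] with [N(0) <> 0], and put
    [T(w,v) = q^(|w|-|v|) binom(w,v)].  Prepending a letter acts by
    [binom(aw,av) = binom(w,av) + T(w,v)], so a congruence refining [~] must
    preserve [T(-,v) mod M] whenever [av] is a factor of [u]; the case of empty
    [v] is (ii).  Modulo [N] this preservation follows from (i) and (ii), as [q]
    is invertible there.  Modulo [q^m], if [|w1| < |w2|] and [T(-,v)] and
    [binom(-,v)] agree on [w1, w2], then [T(w1,v) (1 - q^(|w2|-|w1|))] vanishes,
    hence so do [T(w1,v)] and [T(w2,v)]; this vanishing is (iii). *)

Require Import Defs.
From HB Require Import structures.
From mathcomp Require Import all_boot all_order all_algebra.
From mathcomp Require Import constructive_ereal zify ring.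

Set Implicit Arguments.
Unset Strict Implicit.
Unset Printing Implicit Defensive.

Import Order.TTheory GRing.Theory Num.Theory.
Local Open Scope ring_scope.

(** * Congruences modulo a polynomial *)

Section EqModP.
Variable p : nat.
Implicit Types M N P Q R : {poly 'F_p}.

Lemma eqmodp_refl M P : eqmodp M P P.
Proof. by rewrite /eqmodp subrr dvdp0. Qed.

Lemma eqmodp_sym M P Q : eqmodp M P Q -> eqmodp M Q P.
Proof. by rewrite /eqmodp -opprB dvdpNr. Qed.

Lemma eqmodp_trans M P Q R : eqmodp M P Q -> eqmodp M Q R -> eqmodp M P R.
Proof. by move=> PQ QR; rewrite /eqmodp -(subrKA Q) dvdp_add. Qed.

Lemma eqmodpD M P Q P' Q' :
  eqmodp M P Q -> eqmodp M P' Q' -> eqmodp M (P + P') (Q + Q').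
Proof. by move=> PQ PQ'; rewrite /eqmodp opprD addrACA dvdp_add. Qed.

Lemma eqmodpMl M P Q R : eqmodp M P Q -> eqmodp M (R * P) (R * Q).
Proof. by move=> PQ; rewrite /eqmodp -mulrBr dvdp_mull. Qed.

Lemma eqmodpM M P Q P' Q' :
  eqmodp M P Q -> eqmodp M P' Q' -> eqmodp M (P * P') (Q * Q').
Proof.
move=> PQ PQ'; apply: (eqmodp_trans (eqmodpMl P PQ')).
by rewrite ![_ * Q']mulrC; apply: eqmodpMl.
Qed.

Lemma eqmodp_dvd N M P Q : N %| M -> eqmodp M P Q -> eqmodp N P Q.
Proof. exact: dvdp_trans. Qed.

Lemma eqmodp_dvdp M P Q : eqmodp M P Q -> (M %| P) = (M %| Q).
Proof.
by move=> PQ; rewrite -[in LHS](subrK Q P) dvdp_addr.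
Qed.

Lemma coprimep_Xn P (k : nat) : ~~ root P 0 -> coprimep P 'X^k.
Proof.
by move=> P0; apply: coprimep_expr; rewrite -['X]subr0 coprimep_XsubC.
Qed.

Lemma dvdXmup M : M != 0 -> 'X^(mup 0 M) %| M.
Proof. by move=> M0; have := leqnn (mup 0 M); rewrite mup_geq // subr0. Qed.

(** The cofactor N of the power of q in [M] is prime to ['X^k], so the factor ['X^k] cancels modulo
    N; the power of q itself divides [P] by hypothesis, and these two parts of [M] are coprime. *)
Lemma dvdp_cancelXn M P (k : nat) :
  M != 0 -> 'X^(mup 0 M) %| P -> M %| 'X^k * P -> M %| P.
Proof.
move=> M0 XP MP; have XM := dvdXmup M0; rewrite -(divpK XM) mulrC.
set N := M %/ _.
have cop j : coprimep N 'X^j.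
  (* A root of [N] at 0 would make a higher power of ['X] divide [M] than its multiplicity
     allows. *)
  apply: coprimep_Xn; apply/negP; rewrite -dvdp_XsubCl => /dvdpP[Q NQ].
  have : 'X^((mup 0 M).+1) %| M.
    by rewrite -[X in _ %| X](divpK XM) -/N NQ subr0 -mulrA -exprS dvdp_mulIr.
  by rewrite -['X]subr0 -mup_geq // ltnn.
rewrite Gauss_dvdp ?XP /=; last by rewrite coprimep_sym.
rewrite -(Gauss_dvdpr _ (cop k)); apply: dvdp_trans MP.
by rewrite -(divpK XM); apply: dvdp_mulIl.
Qed.

End EqModP.

Lemma infix_rconsW (T : eqType) (s1 s2 : seq T) (x : T) :
  infix (rcons s1 x) s2 -> infix s1 s2.
Proof. exact/infix_trans/infix_rcons. Qed.

(** * Recursions for binomials and shifted binomials *)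

Section QBinom.
Variables (A : finType) (p : nat).
Implicit Types (u v w : seq A) (a b : A).

Local Notation binom := (qbinomp p).

Lemma qbinomp0 w : binom w [::] = 1.
Proof. by rewrite /qbinomp qbinom0 (rmorph1 (map_poly (GRing.natmul 1))). Qed.

Lemma qbinomp0l v : v != [::] -> binom [::] v = 0.
Proof.
by move=> v0; rewrite /qbinomp qbinom0l // (rmorph0 (map_poly (GRing.natmul 1))).
Qed.

Lemma qbinomp_rcons w v a b :
  binom (rcons w a) (rcons v b) =
  'X^((size v).+1) * binom w (rcons v b) + (a == b)%:R * binom w v.
Proof.
rewrite /qbinomp qbinom_rcons size_rcons.
have morph := (rmorphD (map_poly (GRing.natmul (1 : 'F_p))),
               rmorphM (map_poly (GRing.natmul (1 : 'F_p)))).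
by rewrite !morph /= map_polyXn rmorph_nat.
Qed.

Lemma qbinomp_gt w v : (size w < size v)%N -> binom w v = 0.
Proof.
elim/last_ind: w v => [|w a IH] v; first by case: v => // b v _; rewrite qbinomp0l.
case/lastP: v => // v b; rewrite !size_rcons ltnS => lt_wv.
by rewrite qbinomp_rcons !IH ?size_rcons ?(leqW lt_wv) // !mulr0 addr0.
Qed.

(* Truncated subtraction is harmless, by [qbinomp_gt]. *)
Definition qshift w v : {poly 'F_p} := 'X^(size w - size v) * binom w v.

Lemma qshift0 w : qshift w [::] = 'X^(size w).
Proof. by rewrite /qshift subn0 qbinomp0 mulr1. Qed.

Lemma XnMqshift w v : 'X^(size v) * qshift w v = 'X^(size w) * binom w v.
Proof.
rewrite /qshift; case: (ltnP (size w) (size v)) => [lt_wv | le_vw].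
  by rewrite qbinomp_gt // !mulr0.
by rewrite mulrA -exprD subnKC.
Qed.

(** The binomial sums, over the occurrences of [v] as a subword of [w], q to the number of pairs of
    a chosen letter and a later unchosen one. A chosen new first letter forms such a pair with each
    of the |w|-|v| unchosen letters. The proof compares this with the recursion on last letters. *)
Lemma qbinomp_cons w v a b :
  binom (a :: w) (b :: v) = binom w (b :: v) + (a == b)%:R * qshift w v.
Proof.
elim/last_ind: w v => [|w c IH] v.
  case/lastP: v => [|v d].
    rewrite -[[:: a]]/(rcons [::] a) -[[:: b]]/(rcons [::] b) qbinomp_rcons.
    by rewrite qbinomp0 qbinomp0l // qshift0 mulr0 expr0.
  by rewrite /qshift !qbinomp_gt /= ?size_rcons // !mulr0 addr0.
rewrite -rcons_cons; case/lastP: v => [|v d].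
  rewrite -[[:: b]]/(rcons [::] b) !qbinomp_rcons IH !qbinomp0 !qshift0.
  by rewrite size_rcons expr1 exprS; ring.
rewrite -rcons_cons !qbinomp_rcons !rcons_cons !IH /= /qshift qbinomp_rcons.
rewrite !size_rcons subSS.
(* For |w| <= |v| the truncated exponents may disagree, but both sides are then zero. *)
have Xw : 'X^((size v).+2) * ('X^(size w - (size v).+1) * binom w (rcons v d)) =
    'X^(size w - size v) * ('X^((size v).+1) * binom w (rcons v d)).
  case: (ltnP (size w) (size v).+1) => [lt_wv | le_vw].
    by rewrite qbinomp_gt ?size_rcons // !mulr0.
  by rewrite !mulrA -!exprD; congr ('X^_ * _); lia.
rewrite [LHS](_ : _ = 'X^((size v).+2) * binom w (b :: rcons v d) +
  (a == b)%:R * ('X^((size v).+2) *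
     ('X^(size w - (size v).+1) * binom w (rcons v d))) +
  (c == d)%:R * (binom w (b :: v) +
     (a == b)%:R * ('X^(size w - size v) * binom w v))); first by rewrite Xw; ring.
by ring.
Qed.

(** Only membership in the ideal generated by the two shifted binomials is used later, so one
    coefficient stays existential. *)
Lemma qshift_rcons w v a b :
  exists P, qshift (rcons w a) (rcons v b) =
            P * qshift w (rcons v b) + (a == b)%:R * qshift w v.
Proof.
exists ('X^((size v).+2)); rewrite /qshift qbinomp_rcons !size_rcons subSS.
case: (ltnP (size w) (size v).+1) => [lt_wv | le_vw].
  by rewrite (qbinomp_gt (v := rcons v b)) ?size_rcons // !mulr0 !add0r mulrCA.
rewrite mulrDr mulrCA mulrA -exprD; congr (_ + _); last by rewrite mulrCA.
by rewrite mulrA -exprD; congr ('X^_ * _); lia.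
Qed.

Lemma qshift_cons w v a b :
  exists P, qshift (a :: w) (b :: v) =
            P * qshift w (b :: v) + 'X^(size w - size v) * (a == b)%:R * qshift w v.
Proof.
rewrite /qshift /= subSS qbinomp_cons mulrDr -mulrA.
case: (ltnP (size w) (size v).+1) => [lt_wv | le_vw].
  by exists 0; rewrite (qbinomp_gt (v := b :: v)) //= !mulr0.
exists 'X; congr (_ + _); rewrite mulrA -exprS; congr ('X^_ * _); lia.
Qed.

(** * The valuation condition as divisibility *)

Variable M : {poly 'F_p}.
Hypothesis M0 : M != 0.
Variable u : seq A.

Local Notation m := (mup 0 M).

(** Valuations add over products; when |w|-|v| is negative the binomial is zero and both sides
    hold. *)
Lemma val_condE w v : val_cond M w v <-> 'X^m %| qshift w v.
Proof.
have qM : qval M = m%:Z%:E by rewrite /qval (negPf M0).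
rewrite /val_cond qM /qshift.
have [lt_wv | le_vw] := ltnP (size w) (size v).
  by rewrite qbinomp_gt // mulr0 dvdp0 /qval eqxx leey.
have [->|b0] := eqVneq (binom w v) 0.
  by rewrite mulr0 dvdp0 /qval eqxx leey.
have X0 k : 'X^k != 0 :> {poly 'F_p} by rewrite expf_neq0 // polyX_eq0.
have := mup_geq 0 m (mulf_neq0 (X0 (size w - size v)%N) b0).
rewrite subr0 => <-; rewrite mupM // -['X]subr0 mup_XsubCX eqxx.
rewrite /qval (negPf b0) -EFinD lee_fin; split; lia.
Qed.

Definition qshift_vanish w := forall v a, infix (a :: v) u -> 'X^m %| qshift w v.

Lemma factor_equivE w1 w2 :
  factor_equiv u M w1 w2 <->
  [/\ factor_sim u M w1 w2, eqmodp M 'X^(size w1) 'X^(size w2) &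
      size w1 = size w2 \/ qshift_vanish w1 /\ qshift_vanish w2].
Proof.
split=> -[sim12 q12 [sz12|van]]; split=> //; try by left.
  by right; split=> v a au; apply/val_condE; have [] := van v (ex_intro _ a au).
right=> v [a au]; case: van => van1 van2.
by split; apply/val_condE; [apply: van1 au | apply: van2 au].
Qed.

(** This serves the mixed case of transitivity, where one pair has equal lengths and the other
    satisfies the valuation condition. *)
Lemma qshift_vanish_sim w1 w2 :
  factor_sim u M w1 w2 -> size w1 = size w2 ->
  qshift_vanish w1 -> qshift_vanish w2.
Proof.
move=> sim12 sz12 van1 v a au; rewrite -(@eqmodp_dvdp _ _ (qshift w1 v)).
  exact: van1 au.
rewrite /qshift sz12; apply: eqmodpMl; apply: eqmodp_dvd (dvdXmup M0) _.
exact/sim12/(consl_infix au).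
Qed.

(** * Equivalence and compatibility with concatenation *)

Lemma factor_sim_equivalence : RelationClasses.Equivalence (factor_sim u M).
Proof.
split=> [w v _ | w1 w2 sim12 v vu | w1 w2 w3 sim12 sim23 v vu].
- exact: eqmodp_refl.
- exact/eqmodp_sym/sim12.
- exact: eqmodp_trans (sim12 v vu) (sim23 v vu).
Qed.

Lemma factor_equiv_equivalence : RelationClasses.Equivalence (factor_equiv u M).
Proof.
have [simR simS simT] := factor_sim_equivalence.
split=> [w | w1 w2 | w1 w2 w3].
- by apply/factor_equivE; split; [exact: simR | exact: eqmodp_refl | left].
- move=> /factor_equivE[sim12 q12 c12]; apply/factor_equivE.
  split; [exact: simS | exact: eqmodp_sym |].
  by case: c12 => [->|[]]; [left | right].
move=> /factor_equivE[sim12 q12 c12] /factor_equivE[sim23 q23 c23].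
apply/factor_equivE.
split; [exact: simT sim12 sim23 | exact: eqmodp_trans q12 q23 |].
case: c12 => [sz12|[van1 van2]]; case: c23 => [sz23|[van2' van3]].
- by left; rewrite sz12.
- by right; split=> //; apply: qshift_vanish_sim van2' => //; apply: simS.
- by right; split=> //; apply: qshift_vanish_sim van2.
- by right.
Qed.

(** For unequal lengths, (i) and (ii) give the congruence after multiplication by ['X^(size v)],
    which cancels because the power of q in [M] divides both shifted binomials. *)
Lemma factor_equiv_qshift w1 w2 a v :
  factor_equiv u M w1 w2 -> infix (a :: v) u ->
  eqmodp M (qshift w1 v) (qshift w2 v).
Proof.
move=> /factor_equivE[sim12 q12 c12] au; have bin12 := sim12 v (consl_infix au).
case: c12 => [sz12|[van1 van2]]; first by rewrite /qshift sz12; apply: eqmodpMl.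
apply: (dvdp_cancelXn (k := size v)) => //.
  by rewrite dvdp_sub ?(van1 _ _ au) ?(van2 _ _ au).
by rewrite mulrBr !XnMqshift; apply: eqmodpM.
Qed.

Lemma factor_equiv_rcons w1 w2 c :
  factor_equiv u M w1 w2 -> factor_equiv u M (rcons w1 c) (rcons w2 c).
Proof.
move=> /factor_equivE[sim12 q12 c12]; apply/factor_equivE; split.
- move=> v; case/lastP: v => [|v b] vu; first by rewrite !qbinomp0; apply: eqmodp_refl.
  rewrite !qbinomp_rcons; apply: eqmodpD; apply: eqmodpMl; first exact: sim12.
  exact/sim12/(infix_rconsW vu).
- by rewrite !size_rcons !exprS; apply: eqmodpMl.
case: c12 => [sz12|[van1 van2]]; first by left; rewrite !size_rcons sz12.
suff van w : qshift_vanish w -> qshift_vanish (rcons w c) by right; split; apply: van.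
move=> vanw v a; case/lastP: v => [|v b] au.
  by rewrite qshift0 size_rcons exprS dvdp_mull // -qshift0 (vanw _ _ au).
have [P ->] := qshift_rcons w v c b.
rewrite dvdp_add // dvdp_mull ?(vanw _ _ au) //.
by apply: (vanw v a); apply: (@infix_rconsW _ _ _ b).
Qed.

Lemma factor_equiv_cons w1 w2 c :
  factor_equiv u M w1 w2 -> factor_equiv u M (c :: w1) (c :: w2).
Proof.
move=> equiv12; have /factor_equivE[sim12 q12 c12] := equiv12.
apply/factor_equivE; split.
- case=> [|b v] vu; first by rewrite !qbinomp0; apply: eqmodp_refl.
  rewrite !qbinomp_cons; apply: eqmodpD; first exact: sim12.
  exact/eqmodpMl/(factor_equiv_qshift equiv12 vu).
- by rewrite /= !exprS; apply: eqmodpMl.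
case: c12 => [sz12|[van1 van2]]; first by left; rewrite /= sz12.
suff van w : qshift_vanish w -> qshift_vanish (c :: w) by right; split; apply: van.
move=> vanw [|b v] a au.
  by rewrite qshift0 exprS dvdp_mull // -qshift0 (vanw _ _ au).
(* Both terms vanish: [b :: v] is preceded by [a] in a factor of [u], and [v] by [b]. *)
have [P ->] := qshift_cons w v c b.
by rewrite dvdp_add // dvdp_mull ?(vanw _ _ au) ?(vanw _ _ (consl_infix au)).
Qed.

Lemma factor_equiv_congruence : congruence (factor_equiv u M).
Proof.
split=> [|x y w1 w2 equiv12]; first exact: factor_equiv_equivalence.
elim: x => [|c x IH]; last exact: factor_equiv_cons.
elim/last_ind: y => [|y c IH]; first by rewrite !cats0.
by rewrite -!rcons_cat; apply: factor_equiv_rcons.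
Qed.

Lemma qshift_vanish_lt w1 w2 v :
  (size w1 < size w2)%N -> eqmodp M (binom w1 v) (binom w2 v) ->
  eqmodp M (qshift w1 v) (qshift w2 v) ->
  'X^m %| qshift w1 v /\ 'X^m %| qshift w2 v.
Proof.
move=> lt12 bin12 T12.
rewrite -(eqmodp_dvdp (eqmodp_dvd (dvdXmup M0) T12)).
suff : 'X^m %| qshift w1 v by split.
have [lt_wv | le_vw] := ltnP (size w1) (size v).
  by rewrite /qshift qbinomp_gt // mulr0 dvdp0.
pose d := (size w2 - size w1)%N.
have T2E P : 'X^(size w2 - size v) * P = 'X^d * ('X^(size w1 - size v) * P).
  by rewrite mulrA -exprD; congr ('X^_ * _); rewrite /d; lia.
have T1d : eqmodp M (qshift w1 v) ('X^d * qshift w1 v).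
  apply: (eqmodp_trans T12); rewrite /qshift T2E.
  by do 2!apply: eqmodpMl; apply: eqmodp_sym.
(* As d > 0, the polynomial 1 - q^d takes the value 1 at 0. *)
have cop : coprimep 'X^m (1 - 'X^d : {poly 'F_p}).
  rewrite coprimep_sym coprimep_Xn // /root !hornerE expr0n subn_eq0 leqNgt lt12.
  by rewrite subr0 oner_eq0.
rewrite -(Gauss_dvdpr _ cop) mulrBl mul1r.
exact: eqmodp_dvd (dvdXmup M0) T1d.
Qed.

Lemma factor_equiv_coarsest (R : seq A -> seq A -> Prop) :
  u != [::] -> congruence R -> refines R (factor_sim u M) ->
  refines R (factor_equiv u M).
Proof.
move=> u0 [_ congR] simR w1 w2 R12.
have T12 a v : infix (a :: v) u -> eqmodp M (qshift w1 v) (qshift w2 v).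
  (* Prepending the letter [a] to both words and subtracting the binomials of [a :: v] isolates the
     shifted binomials. *)
  move=> au; have := simR _ _ (congR [:: a] [::] _ _ R12) _ au.
  rewrite !cats0 /= !qbinomp_cons eqxx !mul1r => aw12.
  have := eqmodpD aw12 (eqmodpMl (-1) (simR _ _ R12 _ au)).
  by rewrite !mulN1r ![_ + qshift _ _]addrC !addrK.
apply/factor_equivE; split; first exact: simR.
  (* Condition (ii) is the case of empty [v], with [a] the first letter of [u]. *)
  case: u u0 T12 => // a u' _ /(_ a [::]); rewrite !qshift0; apply.
  by rewrite infix1s mem_head.
have bin12 a v (au : infix (a :: v) u) := simR _ _ R12 v (consl_infix au).
case: (ltngtP (size w1) (size w2)) => [lt12|lt21|]; last by left.
  by right; split=> v a au;
    have [] := qshift_vanish_lt lt12 (bin12 a v au) (T12 a v au).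
by right; split=> v a au;
  have [] := qshift_vanish_lt lt21 (eqmodp_sym (bin12 a v au))
               (eqmodp_sym (T12 a v au)).
Qed.

End QBinom.

Theorem proposition6p12 (A : finType) (p : nat) (p_prime : prime p)
    (u : seq A) (u_nonempty : u <> [::])
    (M : {poly 'F_p}) (degM_ge1 : (1 <= (size M).-1)%N) :
  congruence (factor_equiv u M) /\
  coarsest_congruence_refining (factor_sim u M) (factor_equiv u M).
Proof.
have M0 : M != 0 by apply: contraTneq degM_ge1 => ->; rewrite size_poly0.
have congE := factor_equiv_congruence M0 u.
split=> //; split=> // [w1 w2 []//|R congR simR].
by apply: factor_equiv_coarsest => //; apply/eqP.
Qed.
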